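(* Let $M$ be a matroid of rank $r$ on $n$ elements and let $C$ be a circuit of $M$. Let $d=r+1-|C|$. Then $$\beta_C\ge\binom{n-d}{|C|}^{-1}=\frac{|C|!\,(n-d-|C|)!}{(n-d)!}.$$
   Context: Matroid bingo: let $M$ be a matroid on a finite set $E$ with $|E|=n$ and circuit set $\mathcal{C}$. The elements of $E$ are called out one at a time in a uniformly random order $\sigma(1),\sigma(2),\dots,\sigma(n)$ (a uniformly random permutation of $E$). A circuit $C$ wins in round $t$ if $C\subseteq\{\sigma(1),\dots,\sigma(t)\}$ and no circuit of $M$ is contained in $\{\sigma(1),\dots,\sigma(t-1)\}$; thus the winner is the first circuit to be completed (the circuit axioms guarantee that there is no tie). $\beta_C$ denotes the probability that $C$ wins (in some round). *)

(* Defs.v *)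
From mathcomp Require Import all_boot all_order all_algebra.
Set Implicit Arguments.
Unset Strict Implicit.
Unset Printing Implicit Defensive.

Import GRing.Theory Num.Theory.

Record matroid (E : finType) := Matroid {
  indep : {set {set E}};
  indep0 : set0 \in indep;
  indepS : forall I J : {set E}, J \in indep -> I \subset J -> I \in indep;
  indep_aug : forall I J : {set E}, I \in indep -> J \in indep ->
    #|I| < #|J| -> exists2 x, x \in J :\: I & x |: I \in indep
}.

Definition circuit (E : finType) (M : matroid E) (C : {set E}) : bool :=
  minset [pred A : {set E} | A \notin indep M] C.

Definition rank (E : finType) (M : matroid E) : nat :=
  \max_(I in indep M) #|I|.

(* The orders in which the elements of E can be called: s i is the element    *)
(* called in round i + 1. Being injective between sets of the same size, such *)
(* an s is a bijection.                                                       *)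
Definition orderings (E : finType) : {set {ffun 'I_#|E| -> E}} :=
  [set s : {ffun 'I_#|E| -> E} | injectiveb s].

(* The set of elements called in rounds 1, ..., t. *)
Definition called (E : finType) (s : {ffun 'I_#|E| -> E}) (t : nat) : {set E} :=
  [set s i | i : 'I_#|E| & i < t].

Definition wins_in_round (E : finType) (M : matroid E) (C : {set E})
    (s : {ffun 'I_#|E| -> E}) (t : nat) : bool :=
  (C \subset called s t) &&
  ~~ [exists D : {set E}, circuit M D && (D \subset called s t.-1)].

(* The rounds are numbered 1, ..., #|E|, hence the shift of i : 'I_#|E|. *)
Definition wins (E : finType) (M : matroid E) (C : {set E})
    (s : {ffun 'I_#|E| -> E}) : bool :=
  [exists i : 'I_#|E|, wins_in_round M C s i.+1].

(* The probability that C wins, for s uniformly distributed on orderings E. *)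
Definition beta (E : finType) (M : matroid E) (C : {set E}) : rat :=
  (#|[set s in orderings E | wins M C s]|%:R / #|orderings E|%:R)%R.

(* Since #|C| <= rank M + 1 <= #|E| for a circuit C, the natural-number       *)
(* subtractions d = rank M + 1 - #|C|, #|E| - d and #|E| - d - #|C| are never *)
(* truncated.                                                                 *)
Lemma card_circuit_le (E : finType) (M : matroid E) (C : {set E}) :
  circuit M C -> #|C| <= rank M + 1.
Proof.
move=> /minsetP[/= Cdep Cmin].
have [C0|[x xC]] := set_0Vmem C; first by rewrite C0 indep0 in Cdep.
have indCx : C :\ x \in indep M.
  apply: contraT => dep; have := Cmin _ dep (subD1set C x).
  by move=> eqC; move: xC; rewrite -eqC !inE eqxx.
rewrite (cardsD1 x C) xC addnC leq_add2r /rank.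
exact: (leq_bigmax_cond (F := fun I : {set E} => #|I|) _ indCx).
Qed.

Lemma rank_lt_card (E : finType) (M : matroid E) (C : {set E}) :
  circuit M C -> rank M + 1 <= #|E|.
Proof.
move=> /minsetP[/= Cdep _]; rewrite addn1 /rank.
have [I indI ->] := eq_bigmax_cond (fun I : {set E} => #|I|)
  (introT card_gt0P (ex_intro _ set0 (indep0 M))).
rewrite ltn_neqAle max_card andbT; apply: contra Cdep => /eqP cI.
apply: (indepS indI); suff -> : I = setT by rewrite subsetT.
by apply/eqP; rewrite eqEcard subsetT cardsT cI leqnn.
Qed.

(* Main.v *)
Require Import Defs.
From mathcomp Require Import all_boot all_order all_algebra.
From mathcomp Require Import perm.

(** Extend C minus a point to a basis B, and let D be the set of the [d]
    elements of B outside C. Then C is the only circuit inside C :|: D, so C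
    wins as soon as all of it is called before every other element of ~: D.
    By symmetry each of the #|C|-subsets of ~: D is equally likely to be the
    first one to be called, hence the probability of that event is the inverse
    of a binomial coefficient. *)

(** * Extending a circuit without creating new circuits *)

Section Matroid.

Variables (E : finType) (M : matroid E).
Implicit Types (I J B C S : {set E}).

(** Iterated augmentation, by induction on the gap [#|J| - #|I|]; every added point is taken from
    [J]. *)
Lemma indep_extend I J : I \in indep M -> J \in indep M -> #|I| <= #|J| ->
  exists K : {set E},
    [/\ K \in indep M, I \subset K, K \subset I :|: J & #|K| = #|J|].
Proof.
move=> + indJ; move Em: (#|J| - #|I|) => m.
elim: m I Em => [|m IH] I Em indI leIJ.
  exists I; split=> //; first exact: subsetUl.
  by apply/eqP; rewrite eqn_leq leIJ -subn_eq0 Em.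
have ltIJ : #|I| < #|J| by rewrite -subn_gt0 Em.
have [x /setDP[xJ xI] indxI] := indep_aug indI indJ ltIJ.
have cxI : #|x |: I| = #|I|.+1 by rewrite cardsU1 xI.
have [|//||K [indK sIK sKJ cK]] := IH (x |: I).
- by rewrite cxI subnS Em.
- by rewrite cxI.
exists K; split=> //; first exact: subset_trans (subsetUr _ _) sIK.
by apply: (subset_trans sKJ); rewrite -setUA subUset sub1set !inE xJ orbT /=.
Qed.

Lemma basis_exists : exists2 B, B \in indep M & #|B| = rank M.
Proof.
have [B indB eqB] := eq_bigmax_cond (fun I : {set E} => #|I|)
  (introT card_gt0P (ex_intro _ set0 (indep0 M))).
by exists B.
Qed.

Lemma circuit_dep C : circuit M C -> C \notin indep M.
Proof. by case/minsetP. Qed.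

Lemma circuit_indepD1 C x : circuit M C -> x \in C -> C :\ x \in indep M.
Proof.
move=> /minsetP[_ Cmin] xC; apply: contraT => dep.
by have := Cmin _ dep (subD1set C x) => eqC; move: xC; rewrite -eqC !inE eqxx.
Qed.

Lemma circuit_neq0 C : circuit M C -> C != set0.
Proof. by move=> /circuit_dep; apply: contra => /eqP ->; apply: indep0. Qed.

(** With [B] a basis containing [C :\ x], the set [D = B :\: C] satisfies [C :|: D = x |: B], one
    element more than a basis. Deleting any other [y] of [C] again leaves a basis, by extending
    [C :\ y] inside this set. *)
Lemma circuit_unicyclic_extension C : circuit M C ->
  exists D : {set E}, [/\ #|D| = rank M + 1 - #|C|, [disjoint C & D] &
    forall y, y \in C -> (C :|: D) :\ y \in indep M].
Proof.
move=> cC; have [x xC] := set0Pn _ (circuit_neq0 _ cC).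
have [B0 indB0 cB0] := basis_exists.
have cardCx y : y \in C -> #|C :\ y| <= rank M.
  move=> yC; have := card_circuit_le cC.
  by rewrite (cardsD1 y C) yC addnC leq_add2r.
have [|B [indB sCB _ cB]] :=
  indep_extend _ _ (circuit_indepD1 _ _ cC xC) indB0.
  by rewrite cB0; apply: cardCx.
rewrite cB0 in cB.
have notsub K : K \in indep M -> ~~ (C \subset K).
  by move=> indK; apply: contra (circuit_dep _ cC); apply: indepS.
have xB : x \notin B.
  by apply: contra (notsub _ indB) => xB; rewrite -(setD1K xC) subUset sub1set xB.
have eqU : C :|: (B :\: C) = x |: B.
  apply/setP=> z; rewrite !inE; have [->|zx] /= := eqVneq z x.
    by rewrite xC.
  case zC: (z \in C) => //=.
  by apply/esym/(subsetP sCB); rewrite !inE zx zC.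
have cxB : #|x |: B| = (rank M).+1 by rewrite cardsU1 xB cB.
exists (B :\: C); split.
- have := cardsUI C (B :\: C).
  rewrite eqU cxB setIDA setIC setDIl setDv setIC set0I cards0 addn0 addn1.
  by move=> ->; rewrite addKn.
- by rewrite disjoints_subset; apply/subsetP=> z; rewrite !inE => ->.
move=> y yC; rewrite eqU.
have yxB : y \in x |: B by rewrite -eqU inE yC.
have [|K [indK sCK sK cK]] :=
  indep_extend _ _ (circuit_indepD1 _ _ cC yC) indB.
  by rewrite cB; apply: cardCx.
(* Otherwise the independent set [K] would contain all of [C]. Hence [K] lies in [(x |: B) :\ y],
   and both have [rank M] elements. *)
have yK : y \notin K.
  by apply: contra (notsub _ indK) => yK; rewrite -(setD1K yC) subUset sub1set yK.
suff -> : (x |: B) :\ y = K by [].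
apply/esym/eqP; rewrite eqEcard cK cB; apply/andP; split.
  rewrite subsetD1 yK andbT; apply: (subset_trans sK).
  rewrite -eqU; apply/subsetP=> z; rewrite !inE.
  by case/orP=> [/andP[_ ->] //|->]; rewrite andbT orbN.
by have := cardsD1 y (x |: B); rewrite yxB cxB add1n => -[->].
Qed.

End Matroid.

(** * Counting orderings by symmetry *)

Section Orderings.

Variable E : finType.
Implicit Types (s : {ffun 'I_#|E| -> E}) (A C F : {set E}).

Lemma called0 s : called s 0 = set0.
Proof. by apply/setP=> x; rewrite inE; apply/imsetP=> -[i]; rewrite inE. Qed.

Lemma calledS s (i : 'I_#|E|) : called s i.+1 = s i |: called s i.
Proof.
apply/setP=> x; rewrite !inE; apply/imsetP/orP.
  case=> j; rewrite inE ltnS leq_eqVlt => /orP[/eqP/val_inj -> ->|ltji ->].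
    by left.
  by right; apply: imset_f; rewrite inE.
case=> [/eqP ->|/imsetP[j]]; first by exists i; rewrite ?inE.
by rewrite inE => ltji ->; exists j; rewrite // inE ltnS ltnW.
Qed.

Lemma called_le s t u : t <= u -> called s t \subset called s u.
Proof.
move=> letu; apply: imsetS; apply/subsetP=> i; rewrite !inE => ltit.
exact: leq_trans ltit letu.
Qed.

Lemma called_all s : s \in orderings E -> called s #|E| = setT.
Proof.
rewrite inE => /injectiveP injs; apply/eqP.
have -> : called s #|E| = s @: setT.
  by apply/setP=> x; apply/imsetP/imsetP=> -[i _ ->]; exists i; rewrite ?inE.
by rewrite eqEcard subsetT card_imset // !cardsT card_ord leqnn.
Qed.

(** Calls outside [F] are ignored: [A] is an initial segment of the order that [s] induces on
    [F]. *)
Definition calls_first F A s :=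
  [exists t : 'I_#|E|.+1, called s t :&: F == A].

(** At the least time [t] when at least [k] elements of [F] are called, there are exactly [k], since
    each call adds at most one. *)
Lemma calls_first_exists F k s : s \in orderings E -> k <= #|F| ->
  exists A, [/\ A \subset F, #|A| = k & calls_first F A s].
Proof.
move=> sE lekF.
have ex : exists t, (t <= #|E|) && (k <= #|called s t :&: F|).
  by exists #|E|; rewrite leqnn called_all // setTI.
case: (ex_minnP ex) => t /andP[letE let_k] tmin.
exists (called s t :&: F); split; first exact: subsetIr.
  apply/eqP; rewrite eqn_leq let_k andbT.
  case: t letE tmin {let_k} => [|t] letE tmin.
    by rewrite called0 set0I cards0.
  have ltk : #|called s t :&: F| < k.
    rewrite ltnNge; apply/negP => lek.
    by have := tmin t; rewrite (ltnW letE) lek ltnn => /(_ isT).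
  have := calledS s (Ordinal letE); rewrite /= => ->.
  apply: leq_trans ltk; rewrite setIUl.
  apply: (leq_trans (leq_card_setU _ _)); rewrite -add1n leq_add2r.
  apply: leq_trans (subset_leq_card (subsetIl _ _)) _.
  by rewrite cards1.
by apply/existsP; exists (inord t); rewrite inordK.
Qed.

(** Swapping a point of [A :\: C] with one of [C :\: A] stabilises [F] and shrinks [A :\: C] by one;
    the induction composes such transpositions. *)
Lemma perm_imset_subset F A C : A \subset F -> C \subset F -> #|A| = #|C| ->
  exists2 p : {perm E}, p @: F = F & p @: A = C.
Proof.
move Em: #|A :\: C| => m; elim: m A Em => [|m IH] A Em sAF sCF eqc.
  exists 1%g; first by rewrite (eq_imset F (g := id)) ?imset_id // => x; rewrite perm1.
  rewrite (eq_imset A (g := id)) ?imset_id => [|x]; last by rewrite perm1.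
  by apply/eqP; rewrite eqEcard eqc leqnn andbT -setD_eq0 -cards_eq0 Em.
have cardD : #|C :\: A| = #|A :\: C|.
  by apply/eqP; rewrite !cardsD eqc setIC.
have /card_gt0P[a aAC] : 0 < #|A :\: C| by rewrite Em.
have /card_gt0P[c cCA] : 0 < #|C :\: A| by rewrite cardD Em.
have [aA aC] := setDP aAC; have [cC cA] := setDP cCA.
have tA : tperm a c @: A = c |: (A :\ a).
  apply/setP=> x; rewrite -{1}(tpermK a c x) mem_imset; last exact: perm_inj.
  rewrite !inE; case: tpermP => [->|->|/eqP xa /eqP xc].
  - rewrite (negPf cA) eqxx orbF; apply/esym/eqP => eqac.
    by rewrite eqac cC in aC.
  - by rewrite aA eqxx.
  - by rewrite xa (negPf xc).
have tF : tperm a c @: F = F.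
  apply/setP=> x; rewrite -{1}(tpermK a c x) mem_imset; last exact: perm_inj.
  have aF := subsetP sAF _ aA; have cF := subsetP sCF _ cC.
  by case: tpermP => [->|->|]; rewrite ?aF ?cF.
have [||//||p pF pA] := IH (tperm a c @: A).
- rewrite tA; have -> : (c |: A :\ a) :\: C = (A :\: C) :\ a.
    apply/setP=> x; rewrite !inE; have [->|_] := eqVneq x c.
      by rewrite cC andbF.
    by rewrite andbCA.
  by have := cardsD1 a (A :\: C); rewrite aAC Em => -[].
- by rewrite -tF imsetS.
- by rewrite card_imset //; apply: perm_inj.
have comp (S : {set E}) : (tperm a c * p)%g @: S = p @: (tperm a c @: S).
  by rewrite -imset_comp; apply: eq_imset => x /=; rewrite permM.
by exists (tperm a c * p)%g; rewrite comp ?tF.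
Qed.

(** Composing orderings with a permutation that stabilises [F] and sends [A] to [C] injects the
    first set into the second. *)
Lemma card_calls_first F A C : A \subset F -> C \subset F -> #|A| = #|C| ->
  #|[set s in orderings E | calls_first F A s]|
    <= #|[set s in orderings E | calls_first F C s]|.
Proof.
move=> sAF sCF eqc; have [p pF pA] := perm_imset_subset F A C sAF sCF eqc.
pose g s : {ffun 'I_#|E| -> E} := [ffun i => p (s i)].
have injg : injective g.
  move=> s1 s2 /ffunP eqs; apply/ffunP=> i.
  by have := eqs i; rewrite !ffunE => /perm_inj.
rewrite -(card_imset _ injg); apply: subset_leq_card.
apply/subsetP=> _ /imsetP[s + ->]; rewrite !inE => /andP[/injectiveP injs].
case/existsP=> t /eqP eqA; apply/andP; split.
  by apply/injectiveP => i j; rewrite !ffunE => /perm_inj/injs.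
apply/existsP; exists t; rewrite -pA -eqA imsetI; last by move=> ? ? _ _; apply: perm_inj.
rewrite pF; apply/eqP; congr (_ :&: _).
by rewrite /called -imset_comp; apply: eq_imset => i /=; rewrite ffunE.
Qed.

(** Union bound: every ordering calls first some [#|C|]-subset of [F], and no such subset is
    favoured over [C]. *)
Lemma card_orderings_le F C : C \subset F ->
  #|orderings E|
    <= 'C(#|F|, #|C|) * #|[set s in orderings E | calls_first F C s]|.
Proof.
move=> sCF.
pose draws := [set A : {set E} | A \subset F & #|A| == #|C|].
have cover : orderings E \subset
    \bigcup_(A in draws) [set s in orderings E | calls_first F A s].
  apply/subsetP=> s sE.
  have [A [sAF cA fA]] := calls_first_exists F _ s sE (subset_leq_card sCF).
  by apply/bigcupP; exists A; rewrite inE ?sAF ?cA ?eqxx // sE.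
apply: (leq_trans (subset_leq_card cover)).
rewrite -cards_draws -sum_nat_const.
elim/big_rec2: _ => [|A m S]; first by rewrite cards0.
rewrite inE => /andP[sAF /eqP cA] leSm.
apply: (leq_trans (leq_card_setU _ _)); apply: leq_add => //.
exact: card_calls_first.
Qed.

Lemma orderings_gt0 : 0 < #|orderings E|.
Proof. by rewrite card_inj_ffuns card_ord ffactnn fact_gt0. Qed.

Lemma calls_first_wins (M : matroid E) (C D : {set E}) s : circuit M C ->
  (forall y, y \in C -> (C :|: D) :\ y \in indep M) ->
  calls_first (~: D) C s -> wins M C s.
Proof.
move=> cC indCD /existsP[u /eqP eqC].
have exC : exists t, C \subset called s t.
  by exists u; rewrite -{1}eqC subsetIl.
case: (ex_minnP exC) => t sCt tmin.
(* [t] is the round that completes [C]; until time [u], only elements of [C :|: D] are called. *)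
have letu : t <= u by apply: tmin; rewrite -{1}eqC subsetIl.
case: t sCt tmin letu => [|t] sCt tmin ltu.
  by move: (circuit_neq0 _ _ _ cC); rewrite -subset0 -(called0 s) sCt.
have ltE : t < #|E| by apply: leq_trans ltu _; rewrite -ltnS ltn_ord.
apply/existsP; exists (Ordinal ltE); rewrite /wins_in_round /= sCt /=.
have /subsetPn[y yC yt] : ~~ (C \subset called s t).
  by apply/negP=> /tmin; rewrite ltnn.
(* One round earlier some [y] of [C] is missing, so the called set lies in the independent set
   [(C :|: D) :\ y]. *)
apply/existsP=> -[C' /andP[/circuit_dep/negP depC' sC't]]; apply: depC'.
apply: indepS (indCD _ yC) (subset_trans sC't _).
rewrite subsetD1 yt andbT; apply/subsetP=> z zt; rewrite -eqC !inE.
by rewrite (subsetP (called_le s _ _ (ltnW ltu)) _ zt) orNb.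
Qed.

End Orderings.

Theorem theorem5 (E : finType) (M : matroid E) (n r : nat)
    (hn : #|E| = n) (hr : rank M = r)
    (C : {set E}) (hC : circuit M C)
    (d : nat) (hd : d = (r + 1 - #|C|)%N) :
  ((('C(n - d, #|C|))%:R : rat)^-1 <= beta M C)%R /\
  ((('C(n - d, #|C|))%:R : rat)^-1 =
     (#|C|`! * (n - d - #|C|)`!)%N%:R / ((n - d)`!)%:R)%R.
Proof.
have [D [cD disCD indCD]] := circuit_unicyclic_extension _ _ _ hC.
have sCF : C \subset ~: D by rewrite -disjoints_subset.
have cF : #|~: D| = n - d by rewrite cardsCs setCK cD hn hr hd.
(* This makes the binomial coefficient positive, so its inverse in [rat] is not the default value
   0. *)
have leCF : #|C| <= n - d by rewrite -cF subset_leq_card.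
have bin_neq0 : ('C(n - d, #|C|)%:R : rat)%R != 0%R.
  by rewrite Num.Theory.pnatr_eq0 -lt0n bin_gt0.
split; last first.
  rewrite -(bin_fact leCF) [X in (_ / X)%R]GRing.natrM.
  rewrite GRing.invfM GRing.mulrCA GRing.divff ?GRing.mulr1 //.
  by rewrite Num.Theory.pnatr_eq0 -lt0n muln_gt0 !fact_gt0.
(* Clearing both denominators leaves an inequality between natural numbers, given by
   [card_orderings_le] with [F = ~: D]. *)
rewrite /beta Num.Theory.ler_pdivlMr ?Num.Theory.ltr0n ?orderings_gt0 //.
rewrite GRing.mulrC Num.Theory.ler_pdivrMr ?Num.Theory.ltr0n ?bin_gt0 //.
rewrite -GRing.natrM Num.Theory.ler_nat mulnC.
apply: (leq_trans (card_orderings_le E _ _ sCF)).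
rewrite cF leq_mul2l; apply/orP; right; apply: subset_leq_card.
apply/subsetP=> s; rewrite !inE => /andP[-> /=].
exact: calls_first_wins.
Qed.
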